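(* Any action of the group $\mathrm{Homeo}_{c}(\mathbb{R})$ on the circle has a fixed point: for every group morphism $\psi:\mathrm{Homeo}_{c}(\mathbb{R})\to\mathrm{Homeo}(\mathbb{S}^{1})$ there exists $x\in\mathbb{S}^{1}$ such that $\psi(f)(x)=x$ for all $f\in\mathrm{Homeo}_{c}(\mathbb{R})$.
   Context: $\mathrm{Homeo}_{c}(\mathbb{R})$ is the group of compactly supported homeomorphisms of the real line (those equal to the identity outside a compact set). $\mathrm{Homeo}(\mathbb{S}^{1})$ is the group of homeomorphisms of the circle. *)

(* Defs.v *)
From HB Require Import structures.
From mathcomp Require Import all_boot all_order all_algebra.
From mathcomp Require Import all_classical all_reals all_analysis.
Import numFieldNormedType.Exports.

Set Implicit Arguments.
Unset Strict Implicit.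
Unset Printing Implicit Defensive.

Local Open Scope classical_set_scope.
Local Open Scope group_scope.

(* The inverse is a field of the record, but it is determined by the underlying
   function: see [homeoP]. *)
Record homeo (T : topologicalType) := Homeo {
  homeo_fun :> T -> T;
  homeo_inv : T -> T;
  homeo_funK : cancel homeo_fun homeo_inv;
  homeo_invK : cancel homeo_inv homeo_fun;
  homeo_fun_continuous : continuous homeo_fun;
  homeo_inv_continuous : continuous homeo_inv }.

HB.instance Definition _ (T : topologicalType) := gen_eqMixin (homeo T).
HB.instance Definition _ (T : topologicalType) := gen_choiceMixin (homeo T).

Section homeo_group.
Context {T : topologicalType}.
Implicit Types f g h : homeo T.

Lemma homeoP f g : f =1 g -> f = g.
Proof.
case: f g => [f fi fK fiK fc fic] [g gi gK giK gc gic] /= fg.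
have efg : f = g by apply: funext.
have efgi : fi = gi by apply: funext => x; rewrite -[x in LHS]giK -fg fK.
by subst g gi; congr Homeo; exact: Prop_irrelevance.
Qed.

Definition homeo_one : homeo T :=
  @Homeo T idfun idfun (fun=> erefl) (fun=> erefl)
    (fun x => @cvg_id _ (nbhs x)) (fun x => @cvg_id _ (nbhs x)).

Definition homeo_mul f g : homeo T :=
  Homeo (can_comp (homeo_funK f) (homeo_funK g))
    (can_comp (homeo_invK g) (homeo_invK f))
    (fun x => continuous_comp (@homeo_fun_continuous _ g x)
                              (@homeo_fun_continuous _ f (g x)))
    (fun x => continuous_comp (@homeo_inv_continuous _ f x)
                              (@homeo_inv_continuous _ g (homeo_inv f x))).

Definition homeo_invg f : homeo T :=
  Homeo (homeo_invK f) (homeo_funK f)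
    (@homeo_inv_continuous _ f) (@homeo_fun_continuous _ f).

Fact homeo_mulA : associative homeo_mul.
Proof. by move=> f g h; apply: homeoP. Qed.

Fact homeo_mul1 : left_id homeo_one homeo_mul.
Proof. by move=> f; apply: homeoP. Qed.

Fact homeo_mulr1 : right_id homeo_one homeo_mul.
Proof. by move=> f; apply: homeoP. Qed.

Fact homeo_mulV : left_inverse homeo_one homeo_invg homeo_mul.
Proof. by move=> f; apply: homeoP => x; exact: homeo_funK. Qed.

Fact homeo_mulrV : right_inverse homeo_one homeo_invg homeo_mul.
Proof. by move=> f; apply: homeoP => x; exact: homeo_invK. Qed.

HB.instance Definition _ := isGroup.Build (homeo T)
  homeo_mulA homeo_mul1 homeo_mulr1 homeo_mulV homeo_mulrV.

Lemma homeo1E x : (1 : homeo T) x = x. Proof. by []. Qed.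

Lemma homeoME f g x : (f * g) x = f (g x). Proof. by []. Qed.

Lemma homeoVE f x : f^-1 x = homeo_inv f x. Proof. by []. Qed.

End homeo_group.

Definition compactly_supported (T : topologicalType) : pred (homeo T) :=
  fun f => `[< exists2 K : set T, compact K & forall x, ~ K x -> f x = x >].

Definition homeo_c (T : topologicalType) :=
  {f : homeo T | compactly_supported f}.

Fact compactly_supported_group_closed (T : topologicalType) :
  group_closed (@compactly_supported T).
Proof.
split.
  by apply/asboolP; exists set0 => //; exact: compact0.
move=> f g /asboolP[K cK fK] /asboolP[L cL gL]; apply/asboolP.
exists (K `|` L); first exact: compactU.
move=> x /not_orP[Kx Lx]; rewrite homeoME homeoVE.
by rewrite -[X in homeo_inv g X](gL _ Lx) homeo_funK fK.
Qed.

HB.instance Definition _ (T : topologicalType) := SubChoice.on (homeo_c T).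
HB.instance Definition _ (T : topologicalType) :=
  SubChoice_isSubGroup.Build (homeo T) (@compactly_supported T) (homeo_c T)
    (@compactly_supported_group_closed T).

(* As a type, [circle R] carries the subspace topology of the plane. *)
Definition circle (R : realType) : set (R * R) :=
  [set p | p.1 ^+ 2 + p.2 ^+ 2 = 1]%R.
Arguments circle R : clear implicits.

(* Main.v *)
(* Idea.  For a bounded interval [I], write [G_I] for the homeomorphisms
   supported in [I], and let [t] be a compactly supported homeomorphism that
   contracts [I] to a disjoint interval and whose iterates shrink it to a point.
   The infinite product [F f] of the conjugates [t^n f t^-n], [n >= 0], is a
   homomorphism on [G_I] with [f = F f * t (F f)^-1 t^-1] (Mather's swindle).
   Hence every [psi f] is a commutator, so it is a product of squares and has an
   increasing lift to the universal cover of the circle.  Lifts of commuting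
   homeomorphisms commute, and since [G_I] commutes with the conjugates by [t]
   of the [F f], the lift [F~ t~ F~^-1 t~^-1] of [psi f] depends
   multiplicatively on [f].  It moves [0] by at most 4, so the orbit of [0]
   under these lifts is bounded, and its supremum projects to a point fixed by
   [G_I].  The fixed points of an exhaustion by intervals accumulate, by
   compactness, at a global fixed point. *)
Require Import Defs.
From HB Require Import structures.
From mathcomp Require Import all_boot all_order all_algebra.
From mathcomp Require Import all_classical all_reals all_analysis.
From mathcomp Require Import ring lra.
Import numFieldNormedType.Exports.
Import Order.TTheory GRing.Theory Num.Theory.

Set Implicit Arguments.
Unset Strict Implicit.
Unset Printing Implicit Defensive.

Local Open Scope classical_set_scope.
Local Open Scope ring_scope.

(** * Degree-one maps of the line *)

Section degree_one_maps.
Context {R : realType}.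
Implicit Types (phi chi : R -> R) (x y a : R) (k : int).

(** Increasing lifts of circle maps, seen only through order and periodicity; the estimates below
    use nothing else. *)
Definition degree_one phi :=
  {homo phi : x y / x < y} /\ forall x, phi (x + 1) = phi x + 1.

Lemma degree_one_id : degree_one id.
Proof. by split. Qed.

Lemma degree_one_comp phi chi :
  degree_one phi -> degree_one chi -> degree_one (phi \o chi).
Proof.
move=> [phim phi1] [chim chi1]; split=> [x y xy|x] /=;
  last by rewrite chi1 phi1.
exact/phim/chim.
Qed.

Lemma degree_oneDn phi x (n : nat) :
  degree_one phi -> phi (x + n%:R) = phi x + n%:R.
Proof.
move=> [_ phi1]; elim: n => [|n IHn]; first by rewrite !addr0.
by rewrite -natr1 !addrA phi1 IHn.
Qed.

Lemma degree_oneDz phi x k :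
  degree_one phi -> phi (x + k%:~R) = phi x + k%:~R.
Proof.
move=> phiP; case: k => n; first exact: degree_oneDn.
rewrite NegzE mulrNz; apply: (addIr n.+1%:R).
by rewrite -degree_oneDn// !subrK.
Qed.

Lemma int_gtN1_ge0 k : -1 < k%:~R :> R -> 0 <= k.
Proof. by move=> h; rewrite -ltzD1 -(ltr_int R) rmorph0 rmorphD/=; lra. Qed.

Lemma floor_frac x : exists2 k, 0 <= x - k%:~R & x - k%:~R < 1.
Proof.
exists (Num.floor x); first by rewrite subr_ge0 floor_le.
by have := floorD1_gt x; rewrite rmorphD/=; lra.
Qed.

(** The displacement [phi x - x] is 1-periodic, and for [x] in [0, 1) both [x] and [phi x - phi 0]
    lie in [0, 1). *)
Lemma degree_one_dist phi x :
  degree_one phi -> `|phi x - x - phi 0| <= 1.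
Proof.
move=> phiP; have [phim phi1] := phiP.
have [k] := floor_frac x; set r := x - _ => r0 r1.
have -> : x = r + k%:~R by rewrite subrK.
rewrite degree_oneDz//; have := phi1 0; rewrite add0r => phi1E.
have h1 : phi r < phi 1 by exact: phim.
have h0 : phi 0 <= phi r
  by move: r0; rewrite le_eqVlt => /predU1P[<-//|/phim/ltW].
by rewrite ler_norml; lra.
Qed.

(** For [r] in [0, 1) both [phi r - phi 0] and [chi r - chi 0] lie in [0, 1), so the integers at [r]
    and at 0 differ by less than 1. *)
Lemma degree_one_diff_int phi chi :
  degree_one phi -> degree_one chi ->
  (forall x, exists k, chi x = phi x + k%:~R) ->
  exists k, forall x, chi x = phi x + k%:~R.
Proof.
move=> phiP chiP ex; have [k k0] := ex 0; exists k => x.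
have [m] := floor_frac x; set r := x - _ => r0 r1.
have -> : x = r + m%:~R by rewrite subrK.
rewrite !degree_oneDz//; have [j jr] := ex r.
suff -> : k = j by rewrite jr; ring.
have [phim phi1] := phiP; have [chim chi1] := chiP.
have := phi1 0; have := chi1 0; rewrite add0r => chi1E phi1E.
have h1 : phi r < phi 1 by exact: phim.
have h0 : phi 0 <= phi r
  by move: r0; rewrite le_eqVlt => /predU1P[<-//|/phim/ltW].
have h1' : chi r < chi 1 by exact: chim.
have h0' : chi 0 <= chi r
  by move: r0; rewrite le_eqVlt => /predU1P[<-//|/chim/ltW].
apply/eqP; rewrite -subr_eq0 eq_le; apply/andP; split.
  by rewrite -oppr_ge0 opprB; apply: int_gtN1_ge0; rewrite rmorphB/=; lra.
by apply: int_gtN1_ge0; rewrite rmorphB/=; lra.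
Qed.

Lemma degree_one_commute phi chi k :
  degree_one phi -> degree_one chi ->
  (forall x, phi (chi x) = chi (phi x) + k%:~R) -> k = 0.
Proof.
move=> phiP chiP comm.
(* Two uses of [degree_one_dist] bound the commutation defect by 2. Replacing [chi] by its cube
   triples the defect, so 3|k| <= 2. *)
have comm3 x : phi (chi (chi (chi x))) = chi (chi (chi (phi x))) + k%:~R *+ 3.
  by rewrite !comm !degree_oneDz//; ring.
have chi3P := degree_one_comp chiP (degree_one_comp chiP chiP).
have := degree_one_dist (chi (chi (chi 0))) phiP.
have := degree_one_dist (phi 0) chi3P.
have := comm3 0; rewrite /= !ler_norml => E h1 h2.
apply/eqP; rewrite eq_le; apply/andP; split.
  by rewrite -oppr_ge0; apply: int_gtN1_ge0; rewrite rmorphN/=; lra.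
by apply: int_gtN1_ge0; lra.
Qed.

Lemma degree_one_extension (phi0 : R -> R) a :
  (forall x y, 0 < x -> x < y -> y < 1 -> phi0 x < phi0 y) ->
  (forall x, 0 < x -> x < 1 -> a < phi0 x /\ phi0 x < a + 1) ->
  exists phi, [/\ degree_one phi, phi 0 = a &
    forall x, 0 < x -> x < 1 -> phi x = phi0 x].
Proof.
move=> phi0m phi0I; pose b x := if x == 0 then a else phi0 x.
have bm x y : 0 <= x -> x < y -> y < 1 -> b x < b y.
  rewrite /b => x0 xy y1; rewrite (gt_eqF (le_lt_trans x0 xy)).
  case: eqVneq => [x0'|xn0]; first by have [] := phi0I y (le_lt_trans x0 xy) y1.
  by apply: phi0m => //; rewrite lt_neqAle eq_sym xn0.
have bI x : 0 <= x -> x < 1 -> a <= b x /\ b x < a + 1.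
  rewrite /b => x0 x1; case: eqVneq => [_|xn0]; first by lra.
  have x0' : 0 < x by rewrite lt_neqAle eq_sym xn0.
  by have [/ltW] := phi0I _ x0' x1.
(* Extend [b] from the fundamental domain [0, 1) by commutation with integer translations. *)
pose phi x := b (x - (Num.floor x)%:~R) + (Num.floor x)%:~R.
have floorI x : 0 <= x - (Num.floor x)%:~R /\ x - (Num.floor x)%:~R < 1.
  have := floorD1_gt x; have := floor_le x; rewrite rmorphD/=; lra.
have floor01 x : 0 <= x -> x < 1 -> Num.floor x = 0.
  by move=> x0 x1; apply: floor_def; rewrite rmorphD/=; lra.
exists phi; split.
- split=> [x y xy|x]; last first.
    rewrite /phi [Num.floor (x + 1)]floorDrz ?rpred1// floor1 rmorphD/=.
    rewrite addrA; congr (b _ + _ + _); ring.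
  have /bI bx := proj1 (floorI x); have {bx} := bx (proj2 (floorI x)).
  have /bI hy := proj1 (floorI y); have {hy} := hy (proj2 (floorI y)).
  rewrite /phi; have : (Num.floor x <= Num.floor y) by exact/le_floor/ltW.
  rewrite le_eqVlt => /predU1P[E|].
    move=> _ _; rewrite -E ltrD2r; apply: bm; rewrite ?ltrD2r//.
      by case: (floorI x).
    by rewrite E; case: (floorI y).
  by rewrite -lezD1 -(ler_int R) rmorphD/=; lra.
- by rewrite /phi floor0 subr0 addr0 /b eqxx.
- move=> x x0 x1; rewrite /phi floor01 ?ltW// subr0 addr0 /b gt_eqF//.
Qed.

End degree_one_maps.

(** * The covering of the circle by the line *)

Section circle_cover.
Context {R : realType}.
Implicit Types (x y c : R) (k : int) (p : circle R).

Lemma circle_subproof x : (cos (2 * pi * x), sin (2 * pi * x)) \in circle R.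
Proof. by apply/mem_set; exact: cos2Dsin2. Qed.

Definition circ x : circle R := SigSub (circle_subproof x).

Lemma circle_inj p q : (val p).1 = (val q).1 -> (val p).2 = (val q).2 -> p = q.
Proof.
case: p q => [[p1 p2] hp] [[q1 q2] hq] /= e1 e2.
by apply: val_inj; rewrite /= e1 e2.
Qed.

Lemma circleP p : (val p).1 ^+ 2 + (val p).2 ^+ 2 = 1.
Proof. exact: (set_valP p). Qed.

Lemma circD1 x : circ (x + 1) = circ x.
Proof.
by apply: circle_inj; rewrite /= mulrDr mulr1 mulr_natl ?cosD2pi ?sinD2pi.
Qed.

Lemma circDn x (n : nat) : circ (x + n%:R) = circ x.
Proof. by elim: n => [|n IHn]; rewrite ?addr0// -natr1 addrA circD1. Qed.

Lemma circDz x k : circ (x + k%:~R) = circ x.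
Proof.
case: k => n; first exact: circDn.
by rewrite NegzE mulrNz -[LHS](circDn _ n.+1) subrK.
Qed.

Lemma circ_surj p : exists x, circ x = p.
Proof.
have hp := circleP p; have p1I : -1 <= (val p).1 <= 1 by nra.
have p2E : Num.sqrt (1 - (val p).1 ^+ 2) = `|(val p).2|.
  by rewrite -hp addrC addKr sqrtr_sqr.
have pi0 : 2 * pi != 0 :> R by rewrite mulf_neq0// gt_eqF// pi_gt0.
have [p20|p20] := leP 0 (val p).2.
  exists (acos (val p).1 / (2 * pi)); apply: circle_inj; rewrite /= mulrC divfK//.
    by rewrite acosK// in_itv.
  by rewrite sin_acos// p2E ger0_norm.
exists (- acos (val p).1 / (2 * pi)); apply: circle_inj; rewrite /= mulrC divfK//.
  by rewrite cosN acosK// in_itv.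
by rewrite sinN sin_acos// p2E ltr0_norm// opprK.
Qed.

Lemma circ_surj_itv c p : exists2 x, c <= x < c + 1 & circ x = p.
Proof.
have [y <-] := circ_surj p; have [k k0 k1] := floor_frac (y - c).
by exists (y - k%:~R); [lra|rewrite -(circDz _ k) subrK].
Qed.

Lemma continuous_circ : continuous circ.
Proof.
move=> x U [V [[W oW <-]] /= Wx sub].
have ct : {for x, continuous (fun y => (cos (2 * pi * y), sin (2 * pi * y)))}.
  have lin : {for x, continuous (fun y : R => 2 * pi * y)}.
    exact: (@mulrl_continuous R (2 * pi) x).
  apply: (@cvg_pair _ _ _ (nbhs x)
    (nbhs (cos (2 * pi * x))) (nbhs (sin (2 * pi * x)))).
    exact: (continuous_comp lin (@continuous_cos R _)).
  exact: (continuous_comp lin (@continuous_sin R _)).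
have nW : \forall y \near x, W (cos (2 * pi * y), sin (2 * pi * y)).
  exact: (ct W (open_nbhs_nbhs (conj oW Wx))).
change (\forall y \near x, U (circ y)).
by apply: filterS nW => y Wy; exact: sub.
Qed.

Lemma continuous_circle_fst : continuous (fun p : circle R => (val p).1).
Proof.
move=> p; apply: (@continuous_comp _ _ _ (fun q : circle R => val q) fst).
  exact: initial_continuous.
exact: cvg_fst.
Qed.

Lemma continuous_circle_snd : continuous (fun p : circle R => (val p).2).
Proof.
move=> p; apply: (@continuous_comp _ _ _ (fun q : circle R => val q) snd).
  exact: initial_continuous.
exact: cvg_snd.
Qed.

(** [rot1] and [rot2] are the coordinates of [p] after the rotation that takes [circ c] to (1,
    0). *)
Definition rot1 c p :=
  (val p).1 * cos (2 * pi * c) + (val p).2 * sin (2 * pi * c).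
Definition rot2 c p :=
  (val p).2 * cos (2 * pi * c) - (val p).1 * sin (2 * pi * c).

Lemma rot1_circ c x : rot1 c (circ x) = cos (2 * pi * (x - c)).
Proof. by rewrite /rot1 /= mulrBr cosB. Qed.

Lemma rot2_circ c x : rot2 c (circ x) = sin (2 * pi * (x - c)).
Proof. by rewrite /rot2 /= mulrBr sinB; ring. Qed.

Lemma rot1_eq1 c p : rot1 c p = 1 -> p = circ c.
Proof.
move=> r1; have := circleP p; have := cos2Dsin2 (2 * pi * c); move: r1.
rewrite /rot1; set C := cos _; set S := sin _ => r1 CS ps.
(* The squared chord from [p] to [circ c] is 2 - 2 [rot1 c p]. *)
have : ((val p).1 - C) ^+ 2 + ((val p).2 - S) ^+ 2 = 0 by nra.
move/eqP; rewrite paddr_eq0 ?sqr_ge0// !sqrf_eq0 !subr_eq0.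
move=> /andP[/eqP e1 /eqP e2].
exact: circle_inj.
Qed.

(* Half-angle formula: on the rotated point [(cos (2 a), sin (2 a))], with
   [0 < a < pi], [sin (2 a) / (1 - cos (2 a))] is [tan (pi / 2 - a)]. *)
Definition angle c p := c + 2^-1 - atan (rot2 c p / (1 - rot1 c p)) / pi.

Lemma angle_itv c p : c < angle c p < c + 1.
Proof.
have pi0 := @pi_gt0 R; set a := rot2 c p / (1 - rot1 c p).
have h1 : atan a / pi < 2^-1.
  by rewrite ltr_pdivrMr// mulrC; exact: atan_ltpi2.
have h2 : - 2^-1 < atan a / pi.
  by rewrite ltr_pdivlMr// mulNr mulrC; exact: atan_gtNpi2.
by rewrite /angle -/a; lra.
Qed.

Lemma sin_pi_gt0 x : 0 < x < 1 -> 0 < sin (pi * x).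
Proof.
move=> /andP[x0 x1]; apply: sin_gt0_pi; have pi0 := @pi_gt0 R.
by rewrite mulr_gt0//= gtr_pMr.
Qed.

Lemma angleK c x : c < x < c + 1 -> angle c (circ x) = x.
Proof.
move=> /andP[cx xc]; rewrite /angle rot1_circ rot2_circ.
have xI : 0 < x - c < 1 by lra.
have := sin_pi_gt0 xI; have pi0 := @pi_gt0 R.
set b := pi * (x - c) => sb.
have -> : 2 * pi * (x - c) = b *+ 2 by rewrite /b; ring.
have cb : cos b ^+ 2 = 1 - sin b ^+ 2 by exact: cos2sin2.
have -> : sin (b *+ 2) / (1 - cos (b *+ 2)) = tan (pi / 2 - b).
  rewrite sin_mulr2n cos_mulr2n cb /tan cosB sinB cos_pihalf sin_pihalf.
  by field; rewrite !gt_eqF//=; nra.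
have bI : 0 < b < pi.
  by have /andP[? ?] := xI; rewrite mulr_gt0//= gtr_pMr.
rewrite tanK; last by rewrite in_itv/=; lra.
rewrite /b; move: (pi : R) pi0 => q q0; field; exact: lt0r_neq0.
Qed.

(** Reduce [y - x] modulo 1. A nonzero remainder r would give cos (2 pi r) = 1 - 2 sin (pi r)^2 < 1,
    whereas equal points give 1. *)
Lemma circ_eq x y : circ x = circ y -> exists k, y = x + k%:~R.
Proof.
move=> exy; have [k] := floor_frac (y - x) => k0 k1; exists k.
move: k0; rewrite le_eqVlt => /predU1P[|k0]; first by lra.
have kI : 0 < y - k%:~R - x < 1 by lra.
have := sin_pi_gt0 kI; set b := pi * _ => sb.
have : rot1 x (circ (y - k%:~R)) = 1.
  rewrite -(circDz _ k) subrK -exy rot1_circ subrr mulr0 cos0//.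
rewrite rot1_circ.
have -> : 2 * pi * (y - k%:~R - x) = b *+ 2 by rewrite /b; ring.
by rewrite cos_mulr2n cos2sin2 => ?; nra.
Qed.

Lemma circ_angle c p : p <> circ c -> circ (angle c p) = p.
Proof.
move=> pc; have [x xI xp] := circ_surj_itv c p; rewrite -xp angleK//.
have : x != c by apply/eqP => xc; apply: pc; rewrite -xp xc.
by rewrite lt_neqAle eq_sym => ->/=; lra.
Qed.

Lemma continuous_angle c p : p <> circ c -> {for p, continuous (angle c)}.
Proof.
move=> pc.
have v1 := @continuous_circle_fst p; have v2 := @continuous_circle_snd p.
have r1 : {for p, continuous (rot1 c)}.
  exact: (cvgD (cvgM v1 (cvg_cst _)) (cvgM v2 (cvg_cst _))).
have r2 : {for p, continuous (rot2 c)}.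
  exact: (cvgB (cvgM v2 (cvg_cst _)) (cvgM v1 (cvg_cst _))).
have r10 : 1 - rot1 c p != 0.
  by rewrite subr_eq0 eq_sym; apply/eqP => /rot1_eq1.
have r12 : {for p, continuous (fun q => rot2 c q / (1 - rot1 c q))}.
  exact: (cvgM r2 (cvgV r10 (cvgB (cvg_cst _) r1))).
have ca := continuous_comp r12 (@continuous_atan R _).
exact: (cvgB (cvg_cst _) (cvgM ca (cvg_cst _))).
Qed.

End circle_cover.

(** * Lifts of circle homeomorphisms *)

Section lifts.
Context {R : realType}.
Implicit Types (x y c : R) (k : int) (phi chi : R -> R).
Implicit Types (g h : homeo (circle R)).

Definition homeo_lift g phi :=
  degree_one phi /\ forall x, circ (phi x) = g (circ x).

(* [x |-> - phi x] is a decreasing lift of [g]. *)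
Definition reversing_lift g phi :=
  degree_one phi /\ forall x, circ (- phi x) = g (circ x).

Lemma circ_neq c x : c < x -> x < c + 1 -> circ x <> circ c.
Proof.
move=> cx xc /esym/circ_eq[k E]; move: cx xc; rewrite E => k0 k1.
have : (0 < k) by rewrite -(ltr_int R) rmorph0; lra.
by rewrite gtz0_ge1 -(ler_int R) rmorph1 => ?; lra.
Qed.

Lemma homeo_inj g : injective g.
Proof. exact: can_inj (homeo_funK g). Qed.

Lemma lift_intro g phi : degree_one phi ->
  (forall x, 0 <= x -> x < 1 -> circ (phi x) = g (circ x)) -> homeo_lift g phi.
Proof.
move=> phiP E; split=> // x; have [k k0 k1] := floor_frac x.
rewrite -[in RHS](subrK k%:~R x) circDz -E//.
by rewrite -[RHS](circDz _ k) -degree_oneDz// subrK.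
Qed.

Lemma circNDz x k : circ (- (x + k%:~R)) = circ (- x).
Proof. by rewrite opprD -rmorphN circDz. Qed.

Lemma reversing_lift_intro g phi : degree_one phi ->
  (forall x, 0 <= x -> x < 1 -> circ (- phi x) = g (circ x)) ->
  reversing_lift g phi.
Proof.
move=> phiP E; split=> // x; have [k k0 k1] := floor_frac x.
rewrite -[in RHS](subrK k%:~R x) circDz -E//.
by rewrite -[RHS](circNDz _ k) -degree_oneDz// subrK.
Qed.

(** Cut the source at [circ 0] and the target at its image. In angular coordinates [g] becomes a
    continuous injection of (0, 1) into (c, c + 1), hence strictly monotone; either monotonicity
    extends periodically. *)
Lemma lift_or_reversing_lift g :
  (exists phi, homeo_lift g phi) \/ (exists phi, reversing_lift g phi).
Proof.
have [c cE] := circ_surj (g (circ 0)).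
pose f x := angle c (g (circ x)).
have gneq x : x \in `]0, 1[ -> g (circ x) <> circ c.
  rewrite in_itv/= => /andP[x0 x1]; rewrite cE => /homeo_inj.
  by apply: circ_neq; rewrite ?add0r.
have cf x : x \in `]0, 1[ -> circ (f x) = g (circ x).
  by move=> xI; rewrite circ_angle//; exact: gneq.
have fI x : c < f x /\ f x < c + 1 by apply/andP; exact: angle_itv.
have finj : {in `]0, 1[ &, injective f}.
  move=> x y xI yI; move=> /(congr1 circ); rewrite !cf// => /homeo_inj E.
  move: xI yI; rewrite !in_itv/= => /andP[x0 x1] /andP[y0 y1].
  apply/eqP; rewrite eq_le !leNgt; apply/andP; split; apply/negP => xy.
    by apply: (@circ_neq y x) => //; lra.
  by apply: (@circ_neq x y) => //; lra.
have fcont : {within `]0, 1[, continuous f}.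
  apply: continuous_in_subspaceT => x; rewrite inE /= => xI.
  have cg : {for x, continuous (g \o circ)}.
    exact: (@continuous_comp _ _ _ circ g x (@continuous_circ R x)
      (@homeo_fun_continuous _ g _)).
  exact: (continuous_comp cg (continuous_angle (gneq _ xI))).
have [fm|fm] := itv_continuous_inj_mono fcont finj; [left|right].
  have [|x _ _|phi [phiP phi0 phiE]] := @degree_one_extension R f c.
  - by move=> x y x0 xy y1; apply: fm => //; rewrite in_itv/=; lra.
  - exact: fI.
  exists phi; apply: lift_intro => // x; rewrite le_eqVlt => /predU1P[<- _|x0 x1].
    by rewrite phi0.
  by rewrite phiE// cf// in_itv/=; lra.
(* In the decreasing case [- f] increases, with values between -(c + 1) and -c. *)
have [||phi [phiP phi0 phiE]] := @degree_one_extension R (fun x => - f x) (- (c + 1)).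
- by move=> x y x0 xy y1; rewrite ltrN2; apply: fm => //; rewrite in_itv/=; lra.
- by move=> x _ _; have := fI x; lra.
exists phi; apply: reversing_lift_intro => // x; rewrite le_eqVlt => /predU1P[<- _|x0 x1].
  by rewrite phi0 opprK circD1.
by rewrite phiE// opprK cf// in_itv/=; lra.
Qed.

Lemma lift1 : homeo_lift 1%g id.
Proof. by split; first exact: degree_one_id. Qed.

Lemma lift_mul g h phi chi : homeo_lift g phi -> homeo_lift h chi ->
  homeo_lift (g * h)%g (phi \o chi).
Proof.
move=> [phiP phiE] [chiP chiE]; split; first exact: degree_one_comp.
by move=> x /=; rewrite phiE chiE.
Qed.

(** The composite of a decreasing lift with itself is increasing. *)
Lemma lift_square g : exists phi, homeo_lift (g * g)%g phi.
Proof.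
have [[phi phiP]|[phi [phiP phiE]]] := lift_or_reversing_lift g.
  by exists (phi \o phi); exact: lift_mul.
exists (fun x => - phi (- phi x)); split; last by move=> x; rewrite !phiE.
have [phim phi1] := phiP; split=> [x y xy|x].
  by rewrite ltrN2; apply/phim; rewrite ltrN2; exact: phim.
by have := phi1 (- phi x - 1); rewrite subrK phi1 opprD => ->; ring.
Qed.

(** A commutator is a product of three squares: [g, h] = (g h)^2 (h^-1 g^-1 h)^2 (h^-1)^2. *)
Lemma lift_commutator g h :
  exists phi, homeo_lift (g * (h * g^-1 * h^-1))%g phi.
Proof.
have [phi1 p1] := lift_square (g * h)%g.
have [phi2 p2] := lift_square (h^-1 * g^-1 * h)%g.
have [phi3 p3] := lift_square (h^-1)%g.
exists (phi1 \o phi2 \o phi3).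
suff -> : (g * (h * g^-1 * h^-1) = (g * h * (g * h)) *
    ((h^-1 * g^-1 * h) * (h^-1 * g^-1 * h)) * (h^-1 * h^-1))%g.
  by do 2! apply: lift_mul => //.
apply: homeoP => x; rewrite !homeoME !homeoVE.
by rewrite !homeo_invK.
Qed.

Lemma lift_diff g phi chi : homeo_lift g phi -> homeo_lift g chi ->
  exists k, forall x, chi x = phi x + k%:~R.
Proof.
move=> [phiP phiE] [chiP chiE]; apply: degree_one_diff_int => // x.
by apply: circ_eq; rewrite phiE chiE.
Qed.

Lemma lift_inj g phi : homeo_lift g phi -> injective phi.
Proof.
move=> [[phim _] _] x y E; have [xy|xy|//] := ltgtP x y.
  by have := phim _ _ xy; rewrite E ltxx.
by have := phim _ _ xy; rewrite E ltxx.
Qed.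

(** [phi \o chi] lifts the identity, so it is an integer translation; subtracting that integer from
    [chi] gives the inverse of [phi]. *)
Lemma lift_inverse g phi chi : homeo_lift g phi -> homeo_lift (g^-1)%g chi ->
  exists phi', [/\ homeo_lift (g^-1)%g phi', cancel phi' phi & cancel phi phi'].
Proof.
move=> gphi gchi; have := lift_mul gphi gchi.
rewrite mulgV => /(lift_diff lift1)[k kE].
have phiK : cancel (fun x => chi x + (- k)%:~R) phi.
  move=> x; rewrite degree_oneDz; last by case: gphi.
  by have /= -> := kE x; rewrite rmorphN addrK.
exists (fun x => chi x + (- k)%:~R); split=> //; last first.
  by move=> x; apply: (lift_inj gphi); rewrite phiK.
case: gchi => -[chim chi1] chiE; split; last by move=> x; rewrite circDz.
by split=> [x y xy|x]; [rewrite ltrD2r; exact: chim|rewrite chi1; ring].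
Qed.

(** Both composites lift the same map, so they differ by an integer, which [degree_one_commute]
    shows to be 0. Hence any choice of lifts commutes. *)
Lemma lift_commute g h phi chi : (g * h = h * g)%g ->
  homeo_lift g phi -> homeo_lift h chi ->
  forall x, phi (chi x) = chi (phi x).
Proof.
move=> gh gphi hchi; have := lift_mul gphi hchi; rewrite gh.
move=> /(lift_diff (lift_mul hchi gphi))[k kE] x.
have k0 : k = 0.
  by apply: (degree_one_commute (proj1 gphi) (proj1 hchi)) => y; exact: kE.
by have /= -> := kE x; rewrite k0 rmorph0 addr0.
Qed.

End lifts.

(** * Fixed points from bounded lifts *)

Section lift_pairs.
Context {R : realType}.
Implicit Types (x : R) (g h : homeo (circle R)) (phi chi : R -> R).

(** The inverse lift is carried along so that commutators of lifts can be written down directly. *)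
Definition lift_pair g phi phi' :=
  [/\ homeo_lift g phi, homeo_lift (g^-1)%g phi',
      cancel phi' phi & cancel phi phi'].

Lemma lift_pairV g phi phi' :
  lift_pair g phi phi' -> lift_pair (g^-1)%g phi' phi.
Proof. by case=> ? ? ? ?; split=> //; rewrite invgK. Qed.

Lemma lift_pairM g h phi phi' chi chi' :
  lift_pair g phi phi' -> lift_pair h chi chi' ->
  lift_pair (g * h)%g (phi \o chi) (chi' \o phi').
Proof.
case=> [gl gl' gK gK'] [hl hl' hK hK']; split; rewrite ?invgM.
- exact: lift_mul.
- exact: lift_mul.
- exact: can_comp.
- exact: can_comp.
Qed.

End lift_pairs.

Lemma multiplicativeV (G H : groupType) (f : {multiplicative G -> H}) :
  {morph f : x / (x^-1)%g}.
Proof.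
have f1 : f 1%g = 1%g by apply: (mulgI (f 1%g)); rewrite -gmulfM !mulg1.
by move=> x; apply: (mulgI (f x)); rewrite -gmulfM !mulgV.
Qed.

Section binate.
Context {R : realType} (G : groupType).
Context (psi : {multiplicative G -> homeo (circle R)}).
Hypothesis psi_lift : forall f, exists phi, homeo_lift (psi f) phi.
(** [Q f F] stands for: [f] is supported in I and [F] is the infinite product of the conjugates t^n
    f t^-n. *)
Variables (t : G) (Q : G -> G -> Prop).
Hypothesis QM : forall f F g K, Q f F -> Q g K -> Q (f * g)%g (F * K)%g.
Hypothesis QV : forall f F, Q f F -> Q (f^-1)%g (F^-1)%g.
Hypothesis QE : forall f F, Q f F -> F = (f * (t * F * t^-1))%g.
Hypothesis Qcomm : forall f F g K, Q f F -> Q g K ->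
  (g * (t * F * t^-1) = (t * F * t^-1) * g)%g.

Lemma lift_pair_exists f : exists phi phi', lift_pair (psi f) phi phi'.
Proof.
have [phi pl] := psi_lift f; have [chi] := psi_lift (f^-1)%g.
rewrite multiplicativeV => /(lift_inverse pl)[phi' [pl' K K']].
by exists phi, phi'.
Qed.

Lemma binate_fixed_point : exists x, forall f F, Q f F -> psi f x = x.
Proof.
have [tau [tau' tauP]] := lift_pair_exists t.
have [taul taul' tauK tauK'] := tauP.
(* The commutator of the lifts of [F] and [t], which lifts [psi f]. *)
pose lam (phi phi' : R -> R) := phi \o (tau \o phi' \o tau').
have lamP f F phi phi' : Q f F -> lift_pair (psi F) phi phi' ->
    homeo_lift (psi f) (lam phi phi').
  move=> QfF [pl pl' _ _].
  have -> : f = (F * (t * F^-1 * t^-1))%g.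
    by rewrite {1}(QE QfF) -!mulgA !(mulKg, mulVKg) mulgV mulg1.
  by rewrite !gmulfM !multiplicativeV; do 3! (apply: lift_mul => //).
have lamM f F g K phi phi' chi chi' : Q f F -> Q g K ->
    lift_pair (psi F) phi phi' -> lift_pair (psi K) chi chi' ->
    lam (phi \o chi) (chi' \o phi') =1 lam phi phi' \o lam chi chi'.
  move=> QfF QgK Fp Kp x; have [pl pl' pK pK'] := Fp; rewrite /lam /=.
  have nul : homeo_lift (psi (t * F^-1 * t^-1)%g) (tau \o phi' \o tau').
    by rewrite !gmulfM !multiplicativeV; do 2! (apply: lift_mul => //).
  (* The lift of t F^-1 t^-1 moves past the lift of [g], because these elements commute in the
     group. *)
  have := lift_commute _ nul (lamP _ _ _ _ QgK Kp); rewrite /lam/= => ->.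
    by rewrite tauK'.
  by rewrite -!gmulfM (Qcomm (QV QfF) QgK).
have lamV f F phi phi' : Q f F -> lift_pair (psi F) phi phi' ->
    cancel (lam phi' phi) (lam phi phi').
  move=> QfF Fp x; have Fp' := lift_pairV Fp; rewrite -multiplicativeV in Fp'.
  have [_ _ pK _] := Fp.
  by rewrite -[LHS](lamM _ _ _ _ _ _ _ _ QfF (QV QfF) Fp Fp') /lam /= !pK tauK.
pose S := [set y | exists f F phi phi', [/\ Q f F, lift_pair (psi F) phi phi' &
  y = lam phi phi' 0]].
(* In the commutator the displacements [phi 0] and [tau 0] cancel, and each of the four letters
   costs an error of at most 1. *)
have Sle y : S y -> y <= 4.
  move=> [f [F [phi [phi' [_ [[pd _] _ pK _] ->]]]]]; rewrite /lam /=.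
  have [td _] := taul.
  have := degree_one_dist (tau (phi' (tau' 0))) pd.
  have := degree_one_dist (phi' (tau' 0)) td.
  have := degree_one_dist (phi' (tau' 0)) pd.
  have := degree_one_dist (tau' 0) td.
  by rewrite pK tauK !ler_norml; lra.
have [[f0 [F0 Q0]]|noQ] := pselect (exists f F, Q f F); last first.
  by exists (circ 0) => f F QfF; case: noQ; exists f, F.
have supS : has_sup S.
  split; last by exists 4 => y /Sle.
  have [phi [phi' Fp]] := lift_pair_exists F0.
  by exists (lam phi phi' 0), f0, F0, phi, phi'.
(* The inverse lift of [f] maps the orbit [S] into itself, hence below [sup S]; applying the
   increasing lift of [f] bounds all of [S]. *)
have lam_ge f F phi phi' : Q f F -> lift_pair (psi F) phi phi' ->
    sup S <= lam phi phi' (sup S).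
  move=> QfF Fp; apply: ge_sup; first by case: supS.
  move=> y [g [K [chi [chi' [QgK Kp ->]]]]].
  have Fp' := lift_pairV Fp; rewrite -multiplicativeV in Fp'.
  rewrite -(lamV _ _ _ _ QfF Fp (lam chi chi' 0)).
  have /= <- := lamM _ _ _ _ _ _ _ _ (QV QfF) QgK Fp' Kp 0.
  have [[lm _] _] := lamP _ _ _ _ QfF Fp.
  apply: (ltW_homo lm); apply: sup_upper_bound => //.
  exists (f^-1 * g)%g, (F^-1 * K)%g, (phi' \o chi), (chi' \o phi); split=> //.
    by apply: QM => //; exact: QV.
  by rewrite gmulfM; exact: lift_pairM.
exists (circ (sup S)) => f F QfF.
have [phi [phi' Fp]] := lift_pair_exists F.
have Fp' := lift_pairV Fp; rewrite -multiplicativeV in Fp'.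
have [[lm _] <-] := lamP _ _ _ _ QfF Fp; congr circ.
(* The reverse inequality is [lam_ge] for the inverse of [f], pushed forward by the lift of [f]. *)
apply/eqP; rewrite eq_le (lam_ge _ _ _ _ QfF Fp) andbT
  -[leRHS](lamV _ _ _ _ QfF Fp).
by apply: (ltW_homo lm); exact: (lam_ge _ _ _ _ (QV QfF) Fp').
Qed.

End binate.

(** * Spreading a homeomorphism over dyadic blocks *)

Section increasing_homeo.
Context {R : realType}.
Implicit Types (x y : R) (phi chi : R -> R).

(** A monotone surjection has no jumps: [chi] of [phi x - e] and of [phi x + e] bracket a
    neighbourhood of [x]. *)
Lemma nondecreasing_can_continuous phi chi :
  {homo phi : x y / x <= y} -> cancel chi phi -> continuous phi.
Proof.
move=> phim K x; apply/cvgrPdist_le => e e0.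
have hl : chi (phi x - e) < x.
  by rewrite ltNge; apply/negP => /phim; rewrite K; lra.
have hr : x < chi (phi x + e).
  by rewrite ltNge; apply/negP => /phim; rewrite K; lra.
near=> y.
have : y \in `](chi (phi x - e)), (chi (phi x + e))[.
  by near: y; apply: near_in_itvoo; rewrite in_itv/= hl hr.
rewrite in_itv/= => /andP[/ltW/phim + /ltW/phim]; rewrite !K ler_norml; lra.
Unshelve. all: by end_near. Qed.

Lemma nondecreasing_can phi chi :
  {homo phi : x y / x <= y} -> cancel chi phi -> {homo chi : x y / x <= y}.
Proof.
move=> phim K x y xy; rewrite leNgt; apply/negP => yx.
have := phim _ _ (ltW yx); rewrite !K => yx'.
by move: yx; rewrite (le_anti (introT andP (conj xy yx'))) ltxx.
Qed.

Lemma increasing_homeo phi chi :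
  {homo phi : x y / x <= y} -> cancel phi chi -> cancel chi phi ->
  exists f : homeo R, f =1 phi /\ homeo_inv f =1 chi.
Proof.
move=> phim K K'; have chim := nondecreasing_can phim K'.
by exists (Homeo K K' (nondecreasing_can_continuous phim K')
                 (nondecreasing_can_continuous chim K)).
Qed.

Lemma compactly_supported_itv (f : homeo R) a b :
  (forall x, ~ (a <= x <= b) -> f x = x) -> compactly_supported f.
Proof.
move=> fE; apply/asboolP; exists [set` `[a, b]]; first exact: segment_compact.
by move=> x; rewrite /= in_itv/=; exact: fE.
Qed.

Lemma homeo_c_bounded (f : homeo_c R) :
  exists N : nat, forall x, N%:R <= `|x| -> val f x = x.
Proof.
have /asboolP[K /compact_bounded[M [_ MK]] fK] := valP f.
have [N NM] : exists N : nat, M + 1 < N%:R.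
  exists (Num.bound `|M + 1|).
    exact: le_lt_trans (ler_norm _) (archi_boundP (normr_ge0 _)).
exists N => x Nx; apply: fK => Kx.
have := MK (M + 1) _ x Kx; rewrite ltrDl => /(_ ltr01) /=; lra.
Qed.

(** A continuous injection of the line is monotone, and fixing both N and N + 1 excludes the
    decreasing case. *)
Lemma homeo_c_nondecreasing (f : homeo_c R) : {homo val f : x y / x <= y}.
Proof.
have fc : {within [set` `]-oo, +oo[], continuous (val f)}.
  by apply: continuous_in_subspaceT => x _; exact: homeo_fun_continuous.
have finj : {in `]-oo, +oo[ &, injective (val f)}.
  by move=> x y _ _; exact: (can_inj (homeo_funK (val f))).
have [N NP] := homeo_c_bounded f.
have [fm|fm] := itv_continuous_inj_mono fc finj.
  by apply: ltW_homo => x y; apply: fm; rewrite in_itv.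
have N1 : 0 <= N%:R :> R by [].
have := fm (N%:R + 1) N%:R; rewrite !in_itv/= ltrDl ltr01 => /(_ isT isT isT).
by rewrite !NP ?ger0_norm//; lra.
Qed.

Lemma homeo_cM (f g : homeo_c R) x : val (f * g)%g x = val f (val g x).
Proof. by []. Qed.

Lemma homeo_cV (f : homeo_c R) x : val (f^-1)%g x = homeo_inv (val f) x.
Proof. by []. Qed.

Lemma homeo_cP (f g : homeo_c R) : val f =1 val g -> f = g.
Proof. by move=> fg; apply/val_inj/homeoP. Qed.

End increasing_homeo.

Section spread.
Context {R : realType}.
Implicit Types (x y : R) (f g : R -> R) (n m : nat).

(** The dyadic interval (2^-n, 2^(1-n)), written so that scaling by 2^n visibly takes it to (1,
    2). *)
Definition block n x := (1 < x * 2 ^+ n) && (x * 2 ^+ n < 2).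

Lemma block_lt n m x y : block n x -> block m y -> (n < m)%N -> y < x.
Proof.
move=> /andP[x1 _] /andP[_ y2] nm.
rewrite -(ltr_pM2r (exprn_gt0 m (@ltr0n R 2))).
apply: (lt_le_trans y2); rewrite -(subnKC nm) exprD exprS.
have : 1 <= 2 ^+ (m - n.+1) :> R by rewrite exprn_ege1// ler1n.
nra.
Qed.

Lemma block_uniq n m x : block n x -> block m x -> n = m.
Proof.
move=> bn bm; have [nm|mn|//] := ltngtP n m.
  by have := block_lt bn bm nm; rewrite ltxx.
by have := block_lt bm bn mn; rewrite ltxx.
Qed.

(** The infinite product of the swindle, given pointwise: a copy of [f] scaled by 2^-n on block n,
    the identity off the blocks. The chosen index is unique by [block_uniq]. *)
Definition spread f x :=
  if pselect (exists n, block n x) is left ex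
  then f (x * 2 ^+ projT1 (cid ex)) / 2 ^+ projT1 (cid ex) else x.

Lemma spreadE f n x : block n x -> spread f x = f (x * 2 ^+ n) / 2 ^+ n.
Proof.
move=> bn; rewrite /spread; case: pselect => [ex|[]]; last by exists n.
by rewrite (block_uniq (projT2 (cid ex)) bn).
Qed.

Lemma spread_out f x : ~ (exists n, block n x) -> spread f x = x.
Proof. by rewrite /spread; case: pselect. Qed.

Definition supported12 f := forall x, ~~ (1 < x < 2) -> f x = x.

Lemma supported12_itv f x : injective f -> supported12 f ->
  (1 < f x < 2) = (1 < x < 2).
Proof.
move=> finj fs; apply/idP/idP; apply: contraTT => xI; first by rewrite fs.
by rewrite -(finj _ _ (fs _ xI)).
Qed.

Lemma spread_block f n x : injective f -> supported12 f ->
  block n x -> block n (spread f x).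
Proof.
move=> finj fs bn; rewrite (spreadE f bn) /block divfK ?expf_neq0//.
by rewrite supported12_itv.
Qed.

Lemma spread_comp f g : injective g -> supported12 g ->
  spread (f \o g) =1 spread f \o spread g.
Proof.
move=> ginj gs x /=; have [[n bn]|nb] := pselect (exists n, block n x); last first.
  by rewrite [spread g x]spread_out// !spread_out.
rewrite (spreadE f (spread_block ginj gs bn)) !(spreadE _ bn).
by rewrite divfK ?expf_neq0.
Qed.

Lemma spread_idfun f : f =1 id -> spread f =1 id.
Proof.
move=> fE x; have [[n bn]|nb] := pselect (exists n, block n x); last first.
  by rewrite spread_out.
by rewrite (spreadE _ bn) fE mulfK ?expf_neq0.
Qed.

(** A point left of block n is either fixed or in a block of larger index, which [spread f]
    preserves. *)
Lemma spread_le f n x : injective f -> supported12 f ->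
  x * 2 ^+ n <= 1 -> spread f x * 2 ^+ n <= 1.
Proof.
move=> finj fs xn; have [[m bm]|nb] := pselect (exists m, block m x); last first.
  by rewrite spread_out.
have nm : (n < m)%N.
  rewrite ltnNge; apply/negP => mn; have /andP[x1 _] := bm.
  move: xn; rewrite -(subnKC mn) exprD mulrA.
  have : 1 <= 2 ^+ (n - m) :> R by rewrite exprn_ege1// ler1n.
  nra.
have /andP[_] := spread_block finj fs bm; set y := spread f x.
rewrite -(subnKC nm) exprD exprS.
have e1 : 1 <= 2 ^+ (m - n.+1) :> R by rewrite exprn_ege1// ler1n.
have e0 : 0 < 2 ^+ n :> R by rewrite exprn_gt0.
set E := 2 ^+ (m - _) in e1 *;
have -> : y * (2 * 2 ^+ n * E) = y * 2 ^+ n * E * 2 by ring.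
move=> h; have {}h : y * 2 ^+ n * E < 1 by lra.
by rewrite leNgt; apply/negP => z1; nra.
Qed.

Lemma spread_nondecreasing f : injective f -> supported12 f ->
  {homo f : x y / x <= y} -> {homo spread f : x y / x <= y}.
Proof.
move=> finj fs fm x y xy.
have pow0 n : 0 < 2 ^+ n :> R by rewrite exprn_gt0.
(* Within one block, monotonicity is that of [f]. Otherwise a block endpoint separates [x] from [y],
   and it still separates their images. *)
have [[m bm]|nb] := pselect (exists m, block m y).
  have [bx|/negP] := boolP (block m x).
    rewrite (spreadE _ bm) (spreadE _ bx) ler_pM2r ?invr_gt0//.
    by apply: fm; rewrite ler_pM2r.
  have /andP[_ y2] := bm.
  have xy2 : x * 2 ^+ m <= y * 2 ^+ m by rewrite ler_pM2r.
  move=> nbx; have /(spread_le finj fs) sx : x * 2 ^+ m <= 1.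
    by rewrite leNgt; apply/negP => x1; apply: nbx; rewrite /block x1/=; lra.
  have /andP[sy _] := spread_block finj fs bm.
  by rewrite -(ler_pM2r (pow0 m)); lra.
rewrite [leRHS]spread_out//.
have [[n bn]|nb'] := pselect (exists m, block m x); last by rewrite spread_out.
have /andP[x1 x2] := bn; have /andP[_ sx] := spread_block finj fs bn.
have xyn : x * 2 ^+ n <= y * 2 ^+ n by rewrite ler_pM2r.
rewrite -(ler_pM2r (pow0 n)); apply/ltW/(lt_le_trans sx).
rewrite leNgt; apply/negP => y2; apply: nb; exists n; apply/andP; split=> //; lra.
Qed.

End spread.

(** * Mather's swindle *)

Section mather.
Context {R : realType}.
Implicit Types (x y : R) (f g F K : homeo_c R).

(** The contraction [t]: exact halving on [0, 2] carries block n to block n + 1, and slope 3/2 on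
    [2, 4] rejoins the identity at 4. *)
Definition halving x : R :=
  if x <= 0 then x else if x <= 2 then x / 2
  else if x <= 4 then (3 * x - 4) / 2 else x.

Definition doubling x : R :=
  if x <= 0 then x else if x <= 1 then 2 * x
  else if x <= 4 then (2 * x + 4) / 3 else x.

Lemma halvingK : cancel halving doubling.
Proof.
move=> x; rewrite /halving /doubling.
case: (leP x 0) => [->//|x0]; case: (leP x 2) => [x2|x2].
  by case: (leP (x / 2) 0) => ?; [lra|case: (leP (x / 2) 1) => ?; lra].
case: (leP x 4) => x4; last first.
  case: (leP x 0) => ?; [lra|case: (leP x 1) => ?; first lra].
  by case: (leP x 4) => ?; lra.
set y := (3 * x - 4) / 2; have yE : y = (3 * x - 4) / 2 by [].
case: (leP y 0) => ?; [lra|case: (leP y 1) => ?; first lra].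
by case: (leP y 4) => ?; lra.
Qed.

Lemma doublingK : cancel doubling halving.
Proof.
move=> x; rewrite /halving /doubling.
case: (leP x 0) => [->//|x0]; case: (leP x 1) => [x1|x1].
  by case: (leP (2 * x) 0) => ?; [lra|case: (leP (2 * x) 2) => ?; lra].
case: (leP x 4) => x4; last first.
  case: (leP x 0) => ?; [lra|case: (leP x 2) => ?; first lra].
  by case: (leP x 4) => ?; lra.
set y := (2 * x + 4) / 3; have yE : y = (2 * x + 4) / 3 by [].
case: (leP y 0) => ?; [lra|case: (leP y 2) => ?; first lra].
by case: (leP y 4) => ?; lra.
Qed.

Lemma halving_nondecreasing : {homo halving : x y / x <= y}.
Proof.
move=> x y xy; rewrite /halving.
case: (leP x 0) => ?; case: (leP y 0) => ?; try lra;
case: (leP x 2) => ?; case: (leP y 2) => ?; try lra;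
case: (leP x 4) => ?; case: (leP y 4) => ?; lra.
Qed.

Lemma halving_homeo : exists t : homeo_c R,
  val t =1 halving /\ homeo_inv (val t) =1 doubling.
Proof.
have [t [tE tVE]] := increasing_homeo halving_nondecreasing halvingK doublingK.
have ts : compactly_supported t.
  apply: (@compactly_supported_itv _ _ 0 4) => x xI; rewrite tE /halving.
  case: (leP x 0) => // ?; case: (leP x 2) => ?; first by case: xI; lra.
  by case: (leP x 4) => // ?; case: xI; lra.
by exists (exist _ t ts).
Qed.

Lemma block_doubling n x : block n (doubling x) -> block n.+1 x.
Proof.
have e1 : 1 <= 2 ^+ n :> R by rewrite exprn_ege1// ler1n.
move=> /andP[]; rewrite /block exprS /doubling mulrCA.
set E := 2 ^+ n in e1 *; case: (leP x 0) => ?; first by nra.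
case: (leP x 1) => ?; first by lra.
by case: (leP x 4) => ?; nra.
Qed.

Lemma block_le1 n x : block n.+1 x -> 0 < x <= 1.
Proof.
have e1 : 1 <= 2 ^+ n :> R by rewrite exprn_ege1// ler1n.
move=> /andP[]; rewrite exprS => x1 x2; have x0 : 0 < x by nra.
by rewrite x0/=; nra.
Qed.

Lemma doubling_block n x : block n.+1 x -> block n (doubling x).
Proof.
move=> bx; have /andP[x0 x1] := block_le1 bx; move: bx.
by rewrite /doubling leNgt x0/= x1 /block exprS mulrCA mulrA.
Qed.

(** With the next lemma: conjugating [spread f] by [halving] shifts the blocks by one, which keeps
    the action on blocks n >= 1 and erases it on block 0. *)
Lemma halving_spread_doubling0 (f : R -> R) x : ~ (exists n, block n.+1 x) ->
  halving (spread f (doubling x)) = x.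
Proof.
move=> nb; rewrite spread_out ?doublingK// => -[n /block_doubling bn].
by apply: nb; exists n.
Qed.

Lemma halving_spread_doubling (f : R -> R) n x : injective f -> supported12 f ->
  block n.+1 x -> halving (spread f (doubling x)) = spread f x.
Proof.
move=> finj fs bx; have bd := doubling_block bx.
have bs := spread_block finj fs bx; have := block_le1 bs.
rewrite (spreadE f bd) (spreadE f bx) => /andP[].
have /andP[x0 x1] := block_le1 bx.
have -> : doubling x * 2 ^+ n = x * 2 ^+ n.+1.
  by rewrite /doubling leNgt x0/= x1 exprS; ring.
set z := f _; rewrite exprS invfM [2^-1 * _]mulrC mulrA => z0 z1.
rewrite /halving; case: leP => ?; first by lra.
by case: leP => ?; lra.
Qed.

(** The relation [Q] of the fixed-point argument, for I = (1, 2). *)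
Definition spreads f F := supported12 (val f) /\ val F =1 spread (val f).

Lemma homeo_c_inj f : injective (val f).
Proof. exact: can_inj (homeo_funK (val f)). Qed.

Lemma supported12V f : supported12 (val f) -> supported12 (val (f^-1)%g).
Proof. by move=> fs x /fs {1}<-; rewrite homeo_cV homeo_funK. Qed.

(** Spreading the inverse inverts the spread. Continuity at 0, where the blocks accumulate, comes
    from monotonicity. *)
Lemma spreads_exists f : supported12 (val f) -> exists F, spreads f F.
Proof.
move=> fs; have fsV := supported12V fs.
have finj := @homeo_c_inj f; have finjV := @homeo_c_inj (f^-1)%g.
have sm := spread_nondecreasing finj fs (@homeo_c_nondecreasing _ f).
have K1 : cancel (spread (val f)) (spread (val (f^-1)%g)).
  move=> x; have /= <- := spread_comp (val (f^-1)%g) finj fs x.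
  by apply: spread_idfun => y; exact: homeo_funK.
have K2 : cancel (spread (val (f^-1)%g)) (spread (val f)).
  move=> x; have /= <- := spread_comp (val f) finjV fsV x.
  by apply: spread_idfun => y; exact: homeo_invK.
have [F [FE _]] := increasing_homeo sm K1 K2.
have Fs : compactly_supported F.
  apply: (@compactly_supported_itv _ _ 0 2) => x xI; rewrite FE spread_out//.
  move=> [n /andP[x1 x2]]; apply: xI.
  have e1 : 1 <= 2 ^+ n :> R by rewrite exprn_ege1// ler1n.
  by apply/andP; split; nra.
by exists (exist _ F Fs).
Qed.

Lemma spreadsM f F g K :
  spreads f F -> spreads g K -> spreads (f * g)%g (F * K)%g.
Proof.
move=> [fs FE] [gs KE]; split=> x; first by move=> xI; rewrite homeo_cM gs// fs.
by rewrite homeo_cM FE KE -[LHS](spread_comp _ (@homeo_c_inj g) gs).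
Qed.

Lemma spreadsV f F : spreads f F -> spreads (f^-1)%g (F^-1)%g.
Proof.
move=> [fs FE]; have fsV := supported12V fs; split=> // x.
apply: (@homeo_c_inj F); rewrite homeo_cV homeo_invK FE.
rewrite -[RHS](spread_comp _ (@homeo_c_inj (f^-1)%g) fsV).
by rewrite spread_idfun// => y; exact: homeo_invK.
Qed.

(** Block 0 of [F] is [f] and the remaining blocks form t F t^-1. The latter moves only points of
    (0, 1], so it commutes with every [g] supported in (1, 2). *)
Lemma mather_swindle : exists t : homeo_c R,
  (forall f F, spreads f F -> F = (f * (t * F * t^-1))%g) /\
  (forall f F g K, spreads f F -> spreads g K ->
     (g * (t * F * t^-1) = (t * F * t^-1) * g)%g).
Proof.
have [t [tE tVE]] := halving_homeo; exists t.
have tFE F x : val (t * F * t^-1)%g x = halving (val F (doubling x)).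
  by rewrite !homeo_cM homeo_cV tE tVE.
split=> [f F [fs FE]|f F g K [fs FE] [gs KE]]; apply: homeo_cP => x.
  rewrite (homeo_cM f) tFE !FE.
  have [[n bn]|nb] := pselect (exists n, block n.+1 x).
    rewrite (halving_spread_doubling (@homeo_c_inj f) fs bn) fs//.
    have /block_le1 := spread_block (@homeo_c_inj f) fs bn; lra.
  rewrite halving_spread_doubling0//.
  have [bx|nbx] := boolP (block 0 x); first by rewrite (spreadE _ bx) mulr1 divr1.
  rewrite spread_out ?fs//; first by move: nbx; rewrite /block mulr1.
  by move=> [[|n] bn]; [rewrite bn in nbx|apply: nb; exists n].
rewrite (homeo_cM g) (homeo_cM (t * F * t^-1)%g) !tFE !FE.
have [[n bn]|nb] := pselect (exists n, block n.+1 x).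
  have nI : ~~ (1 < x < 2) by have := block_le1 bn; lra.
  rewrite [val g x]gs// (halving_spread_doubling (@homeo_c_inj f) fs bn) gs//.
  have /block_le1 := spread_block (@homeo_c_inj f) fs bn; lra.
(* It remains to see that [g x] is in no block of positive index: [g] preserves (1, 2) and fixes all
   other points. *)
rewrite !halving_spread_doubling0// => -[n bn].
have [xI|xI] := boolP (1 < x < 2); last by apply: nb; exists n; rewrite gs in bn.
have := supported12_itv x (@homeo_c_inj g) gs; rewrite xI.
by have := block_le1 bn; lra.
Qed.

End mather.

(** * Conjugating compact supports into (1, 2) *)

Section conjugation.
Context {R : realType}.

Lemma compactly_supported_conj (T : topologicalType) (a f : homeo T) :
  compactly_supported f -> compactly_supported (a * f * a^-1)%g.
Proof.
move=> /asboolP[K cK fK]; apply/asboolP; exists (a @` K).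
  apply: continuous_compact => //; apply: continuous_subspaceT.
  exact: homeo_fun_continuous.
move=> x aKx; rewrite !homeoME homeoVE fK ?homeo_invK// => Kx.
by apply: aKx; exists (homeo_inv a x); rewrite ?homeo_invK.
Qed.

(** The conjugator need not have compact support: it will be affine. *)
Definition conj_c (T : topologicalType) (a : homeo T) (f : homeo_c T) :
    homeo_c T :=
  exist _ (a * val f * a^-1)%g (compactly_supported_conj a (valP f)).

Lemma conj_cM (T : topologicalType) (a : homeo T) :
  {morph conj_c a : f g / (f * g)%g}.
Proof.
by move=> f g; apply/val_inj/homeoP => x /=; rewrite homeo_funK.
Qed.

HB.instance Definition _ (T : topologicalType) (a : homeo T) :=
  isMultiplicative.Build (homeo_c T) (homeo_c T) (conj_c a) (conj_cM a).

Lemma conj_cK (T : topologicalType) (a : homeo T) :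
  cancel (conj_c a) (conj_c (a^-1)%g).
Proof.
move=> f; apply/val_inj/homeoP => x /=.
by rewrite !homeo_funK.
Qed.

Lemma affine_homeo (N : nat) : exists a : homeo R,
  forall f : homeo_c R, (forall x, N.+1%:R <= `|x| -> val f x = x) ->
  supported12 (val (conj_c a f)).
Proof.
(* The increasing affine map from [-(N + 1), N + 1] onto [1, 2]; the successor keeps the radius
   positive. *)
pose phi x : R := (x / N.+1%:R + 3) / 2.
pose chi x : R := N.+1%:R * (2 * x - 3).
have N0 : 0 < N.+1%:R :> R by [].
have pm : {homo phi : x y / x <= y}.
  by move=> x y xy; rewrite /phi ler_pM2r// lerD2r ler_pM2r// invr_gt0.
have K : cancel phi chi by move=> x; rewrite /phi /chi; field; rewrite lt0r_neq0.
have K' : cancel chi phi by move=> x; rewrite /phi /chi; field; rewrite lt0r_neq0.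
have [a [aE aVE]] := increasing_homeo pm K K'; exists a => f fN x xI.
rewrite /= fN ?homeo_invK// aVE /chi normrM gtr0_norm//.
by rewrite ler_pMr// leNgt ltr_norml; apply: contra xI; lra.
Qed.

End conjugation.

(** * The global fixed point, by compactness *)

Theorem proposition3p9 (R : realType)
    (psi : {multiplicative homeo_c R -> homeo (circle R)}) :
  exists x : circle R, forall f : homeo_c R, psi f x = x.
Proof.
have [t [tE tcomm]] := @mather_swindle R.
(* Precomposing with a conjugation makes supports in a large interval look like supports in (1,
   2). *)
pose psi' (a : homeo R) : {multiplicative homeo_c R -> homeo (circle R)} :=
  psi \o conj_c (a^-1)%g.
have psi'E a f : psi' a (conj_c a f) = psi f by rewrite /= conj_cK.
have psi_lift f : exists phi, homeo_lift (psi f) phi.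
  have [N NP] := homeo_c_bounded f; have [a aP] := affine_homeo (R := R) N.
  have fs : supported12 (val (conj_c a f)).
    by apply: aP => x xN; apply: NP; apply: le_trans xN; rewrite ler_nat.
  have [F FP] := spreads_exists fs.
  have E : conj_c a f = (F * (t * F^-1 * t^-1))%g.
    by rewrite {1}(tE _ _ FP) -!mulgA !(mulKg, mulVKg) mulgV mulg1.
  rewrite -(psi'E a) E !gmulfM !multiplicativeV.
  exact: lift_commutator.
have fixN (N : nat) : exists x : circle R, forall f : homeo_c R,
    (forall y, N.+1%:R <= `|y| -> val f y = y) -> psi f x = x.
  have [a aP] := affine_homeo (R := R) N.
  have [x xP] := binate_fixed_point (psi := psi' a) (fun f => psi_lift _)
    spreadsM spreadsV tE tcomm.
  exists x => f /aP/spreads_exists[F FP].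
  by rewrite -(psi'E a); exact: xP FP.
have [x xP] := choice fixN.
have cS : compact [set: circle R].
  have -> : [set: circle R] = circ @` `[0, 1].
    apply/seteqP; split=> // p _; have [y yI <-] := circ_surj_itv 0 p.
    by exists y => //; rewrite /= in_itv/=; lra.
  apply: continuous_compact; last exact: segment_compact.
  by apply: continuous_subspaceT; exact: continuous_circ.
have [p [_ pP]] := cS (x @ \oo) _ filterT.
exists p => f; have [N NP] := homeo_c_bounded f.
(* [u] vanishes at [x n] for all n >= N. Were [u p] nonzero, [u] would be nonzero near the cluster
   point [p]. This is applied to both coordinates of the displacement of [psi f]. *)
have eventually0 (u : circle R -> R) : {for p, continuous u} ->
    (forall q, psi f q = q -> u q = 0) -> u p = 0.
  move=> uc u0; apply: contrapT => /eqP up.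
  have un : (x @ \oo) [set q | u q = 0].
    exists N => // n /= Nn; apply/u0/xP => y ny; apply: NP; apply: le_trans ny.
    by rewrite ler_nat ltnW.
  have [q [/= uq0]] := pP _ _ un (cvgr_neq0 _ uc up).
  by rewrite uq0 eqxx.
have fc := @homeo_fun_continuous _ (psi f) p.
have c1 := @continuous_circle_fst R; have c2 := @continuous_circle_snd R.
apply: circle_inj; apply/eqP; rewrite -subr_eq0; apply/eqP.
  apply: (eventually0 (fun q => (val (psi f q)).1 - (val q).1)) => [|q ->].
    exact: (cvgB (continuous_comp fc (c1 _)) (c1 _)).
  exact: subrr.
apply: (eventually0 (fun q => (val (psi f q)).2 - (val q).2)) => [|q ->].
  exact: (cvgB (continuous_comp fc (c2 _)) (c2 _)).
exact: subrr.
Qed.
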